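(* Let $p>0$, let $m\ge 1$ be an odd integer, and let $\bar y=\frac{1+\sqrt{1+4p}}{2}$. Let $\{y_n\}_{n=-m}^{\infty}$ be a positive solution of $$y_{n+1}=1+p\,\frac{y_{n-m}}{y_n^{2}},\qquad n=0,1,2,\dots,$$ whose initial values satisfy $$y_{-m},y_{-m+2},\dots,y_{-1}\le \bar y\quad\text{and}\quad y_{-m+1},y_{-m+3},\dots,y_{0}>\bar y.$$ Then every semi-cycle of the solution has length one. Additionally, the solution $\{y_n\}_{n=-m}^{\infty}$ is oscillatory about the unique positive equilibrium point $\bar y$.
   Context: A positive solution is a sequence of positive real numbers $\{y_n\}_{n=-m}^{\infty}$ satisfying the recurrence for all $n\ge 0$. The number $\bar y$ is the unique positive equilibrium point of the equation. A positive semi-cycle of a solution is a maximal string of consecutive terms all of which are $>\bar y$; a negative semi-cycle is a maximal string of consecutive terms all of which are $\le\bar y$; a semi-cycle is a positive or a negative semi-cycle, and its length is its number of terms. A solution is oscillatory about $\bar y$ if the sequence $y_n-\bar y$ is neither eventually positive nor eventually negative. *)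

(* Defs.v *)
From HB Require Import structures.
From mathcomp Require Import all_boot all_order all_algebra.
From mathcomp Require Import classical_sets cardinality reals num_normedtype.

Set Implicit Arguments.
Unset Strict Implicit.
Unset Printing Implicit Defensive.

Import Order.TTheory GRing.Theory Num.Theory.

Local Open Scope classical_set_scope.
Local Open Scope card_scope.
Local Open Scope ring_scope.

(* A sequence {y_n}_{n >= -m} is a function y : int -> R; the values of y at
   indices below -m are irrelevant to every notion below. *)

(* The recurrence is y_{n+1} = rec_map p y_{n-m} y_n. *)
Definition rec_map (R : realType) (p u v : R) : R := 1 + p * (u / v ^+ 2).

Definition positive_solution (R : realType) (p : R) (m : nat) (y : int -> R) :=
  (forall n : int, - m%:Z <= n -> 0 < y n) /\
  (forall n : int, 0 <= n -> y (n + 1) = rec_map p (y (n - m%:Z)) (y n)).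

Definition positive_equilibrium (R : realType) (p z : R) :=
  0 < z /\ z = rec_map p z z.

Definition ybar (R : realType) (p : R) : R := (1 + Num.sqrt (1 + 4 * p)) / 2.

(* A string of consecutive terms is represented by its set of indices, a
   nonempty, possibly infinite, interval of {-m, -m+1, ...}. *)
Definition index_string (m : nat) (I : set int) :=
  [/\ I !=set0, I `<=` [set n | - m%:Z <= n] & is_interval I].

Definition maximal_string (m : nat) (P : int -> Prop) (I : set int) :=
  [/\ index_string m I, (forall n, I n -> P n) &
      forall J : set int, index_string m J -> (forall n, J n -> P n) ->
        I `<=` J -> J = I].

Definition positive_semicycle (R : realType) (m : nat) (c : R) (y : int -> R) :=
  maximal_string m (fun n => c < y n).

Definition negative_semicycle (R : realType) (m : nat) (c : R) (y : int -> R) :=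
  maximal_string m (fun n => y n <= c).

Definition semicycle (R : realType) (m : nat) (c : R) (y : int -> R)
    (I : set int) :=
  positive_semicycle m c y I \/ negative_semicycle m c y I.

Definition has_length (I : set int) (k : nat) := I #= `I_k.

Definition eventually_idx (P : int -> Prop) :=
  exists N : int, forall n : int, N <= n -> P n.

Definition oscillatory_about (R : realType) (c : R) (y : int -> R) :=
  ~ eventually_idx (fun n => 0 < y n - c) /\
  ~ eventually_idx (fun n => y n - c < 0).

(* Main.v *)
Require Import Defs.
From HB Require Import structures.
From mathcomp Require Import all_boot all_order all_algebra.
From mathcomp Require Import classical_sets cardinality reals num_normedtype.
From mathcomp Require Import zify ring lra.

(** Write [c] for the equilibrium, so that [c ^ 2 = c + p], equivalently
    [c = 1 + p * (c / c ^ 2)].  The map [1 + p * (u / v ^ 2)] increases in [u]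
    and decreases in [v] for positive [u] and [v], hence its value lies above
    [c] when [v <= c < u] and below [c] when [u <= c < v] ([rec_map_above],
    [rec_map_below]).

    The delay [m] is odd, so the two terms [y_(n-m)] and [y_n] from which
    [y_(n+1)] is computed have indices of opposite parity, and [n - m] has the
    parity of [n + 1].  If the terms alternate around [c] up to index [n], then
    [y_(n-m)] and [y_n] lie on opposite sides of [c], and [y_(n+1)] falls on
    the side of [y_(n-m)]: the alternation of the initial values propagates
    forever ([solution_alternates]).  Consecutive terms are thus always on
    opposite sides of [c], which makes every semi-cycle a single term
    ([maximal_string_length1]) and prevents [y_n - c] from having an eventual
    sign.  The equilibrium is unique because an equilibrium is a positive root
    of [z ^ 2 = z + p], whose two roots have product [- p < 0]. *)

Set Implicit Arguments.
Unset Strict Implicit.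
Unset Printing Implicit Defensive.

Import Order.TTheory GRing.Theory Num.Theory.

Local Open Scope classical_set_scope.
Local Open Scope ring_scope.

Lemma ybar_gt1 (R : realType) (p : R) : 0 < p -> 1 < ybar p.
Proof.
move=> p0; rewrite /ybar.
have : Num.sqrt 1 < Num.sqrt (1 + 4 * p) by rewrite ltr_sqrt; lra.
by rewrite sqrtr1; lra.
Qed.

Lemma ybar_sqr (R : realType) (p : R) : 0 < p -> ybar p ^+ 2 = ybar p + p.
Proof.
move=> p0; rewrite /ybar.
have : Num.sqrt (1 + 4 * p) ^+ 2 = 1 + 4 * p by rewrite sqr_sqrtr; lra.
by move: (Num.sqrt _) => s hs; nra.
Qed.

Lemma rec_map_fixed (R : realType) (p z : R) :
  0 < z -> (z = rec_map p z z) <-> (z ^+ 2 = z + p).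
Proof.
move=> z0; have z_neq0 : z != 0 by rewrite gt_eqF.
have -> : rec_map p z z = (z + p) / z by rewrite /rec_map; field.
split=> [h|<-]; last by field.
by rewrite {1}expr2 {1}h; field.
Qed.

Lemma ybar_unique_equilibrium (R : realType) (p : R) :
  0 < p -> unique (positive_equilibrium p) (ybar p).
Proof.
move=> p0; have c1 := ybar_gt1 p0; have c0 : 0 < ybar p by lra.
have csq := ybar_sqr p0.
split; first by split=> //; apply/rec_map_fixed.
move=> z [z0 /(rec_map_fixed p z0) zsq].
(* The other root of the quadratic is 1 - c, which is negative. *)
have : (ybar p - z) * (ybar p + z - 1) = 0.
  transitivity ((ybar p ^+ 2 - ybar p) - (z ^+ 2 - z)); first by ring.
  by rewrite csq zsq; ring.
by move/eqP; rewrite mulf_eq0 => /orP[] /eqP; lra.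
Qed.

Lemma rec_map_above (R : realType) (p c u v : R) :
  0 < p -> c = rec_map p c c -> 0 < v -> v <= c -> c < u -> c < rec_map p u v.
Proof.
move=> p0 cE v0 vc cu; rewrite {1}cE ltrD2l ltr_pM2l //.
have c0 : 0 < c by apply: lt_le_trans vc.
apply: (@lt_le_trans _ _ (u / c ^+ 2)).
  by rewrite ltr_pM2r // invr_gt0 exprn_gt0.
rewrite ler_pM2l; last exact: lt_trans cu.
by rewrite lef_pV2 ?posrE ?exprn_gt0 // ler_pXn2r // nnegrE ltW.
Qed.

Lemma rec_map_below (R : realType) (p c u v : R) :
  0 < p -> c = rec_map p c c -> 0 < u -> u <= c -> c < v -> rec_map p u v < c.
Proof.
move=> p0 cE u0 uc cv; rewrite {1}cE ltrD2l ltr_pM2l //.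
have c0 : 0 < c by apply: lt_le_trans uc.
have v0 : 0 < v by apply: lt_trans cv.
apply: (@lt_le_trans _ _ (u / c ^+ 2)).
  rewrite ltr_pM2l // ltf_pV2 ?posrE ?exprn_gt0 //.
  by rewrite ltr_pXn2r // nnegrE ltW.
by rewrite ler_pM2r // invr_gt0 exprn_gt0.
Qed.

(** Counting indices from [- m] turns the recurrence into one that expresses
    the term [m + 1 + j] by the terms [j] and [m + j], so that a single strong
    induction on natural numbers carries the sign pattern. *)
Lemma solution_alternates (R : realType) (p c : R) (m : nat) (y : int -> R) :
  0 < p -> c = rec_map p c c -> odd m -> positive_solution p m y ->
  (forall i : nat, (i.*2 < m)%N -> y (- m%:Z + i.*2%:Z) <= c) ->
  (forall i : nat, (i.*2 < m)%N -> c < y (- m%:Z + i.*2.+1%:Z)) ->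
  forall k : nat, (c < y (- m%:Z + k%:Z)) = odd k.
Proof.
move=> p0 cE m_odd [y0 yrec] hle hgt; elim/ltn_ind=> k IHk.
have [km|mk] := leqP k m.
  have := odd_double_half k; case: (boolP (odd k)) => k_odd /= kE.
    by rewrite -kE add1n hgt //; lia.
  apply/negbTE; rewrite -leNgt -kE add0n hle //.
  (* k = m is excluded since m is odd *)
  move: km; rewrite leq_eqVlt => /orP[/eqP km|]; last by lia.
  by rewrite km m_odd in k_odd.
have [j kE] : exists j, k = (m + j).+1 by exists (k - m.+1)%N; lia.
have jk : (j < k)%N by lia.
have mjk : (m + j < k)%N by lia.
have -> : - m%:Z + k%:Z = j%:Z + 1 :> int by lia.
have := IHk _ jk; have := IHk _ mjk.
rewrite yrec //.
have -> : - m%:Z + (m + j)%N%:Z = j%:Z :> int by lia.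
have -> : - m%:Z + j%:Z = j%:Z - m%:Z :> int by lia.
have u0 : 0 < y (j%:Z - m%:Z) by apply: y0; lia.
have v0 : 0 < y j%:Z by apply: y0; lia.
rewrite kE /= oddD m_odd /= negbK; case: (odd j) => /=.
  move=> /negbT; rewrite -leNgt => vc cu.
  exact: rec_map_above.
move=> cv /negbT; rewrite -leNgt => uc.
by apply/negbTE; rewrite -leNgt ltW // rec_map_below.
Qed.

(** A string with two distinct indices contains, being an interval, two
    consecutive ones. *)
Lemma maximal_string_length1 (m : nat) (P : int -> Prop) (I : set int) :
  (forall n : int, - m%:Z <= n -> P n -> ~ P (n + 1)) ->
  maximal_string m P I -> has_length I 1.
Proof.
move=> altP [[[a Ia] I_ge I_itv] IP _].
have no_succ n : I n -> ~ I (n + 1).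
  by move=> In /IP; apply: altP; [exact: I_ge | exact: IP].
have not_lt b d : I b -> I d -> ~ (b < d).
  move=> Ib Id bd; apply: (no_succ b Ib).
  by apply: (I_itv b d) => //; lia.
suff -> : I = [set a] by exact: card_set1.
apply/seteqP; split=> [b Ib /=|b -> //].
by have [/(not_lt _ _ Ib Ia)|/(not_lt _ _ Ia Ib)|] := ltgtP b a.
Qed.

Theorem theorem8 (R : realType) (p : R) (m : nat) (y : int -> R)
  (hp : 0 < p) (hm1 : (1 <= m)%N) (hmodd : odd m)
  (hy : positive_solution p m y)
  (hle : forall i : nat, (i.*2 < m)%N -> y (- m%:Z + i.*2%:Z) <= ybar p)
  (hgt : forall i : nat, (i.*2 < m)%N -> ybar p < y (- m%:Z + i.*2.+1%:Z)) :
  (forall I : set int, semicycle m (ybar p) y I -> has_length I 1) /\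
  (unique (positive_equilibrium p) (ybar p) /\ oscillatory_about (ybar p) y).
Proof.
have c_uniq := ybar_unique_equilibrium hp.
have [[_ cE] _] := c_uniq.
have alt := solution_alternates hp cE hmodd hy hle hgt.
have altS (n : int) : - m%:Z <= n -> (ybar p < y (n + 1)) = ~~ (ybar p < y n).
  move=> n_ge; have [k nE] : exists k : nat, n = - m%:Z + k%:Z.
    by exists (absz (n + m%:Z)); lia.
  have -> : n + 1 = - m%:Z + k.+1%:Z by lia.
  by rewrite nE !alt.
split; first move=> I [].
- by apply: maximal_string_length1 => n /altS -> ->.
- by apply: maximal_string_length1 => n /altS; rewrite !leNgt => -> ->.
split=> //; split=> -[N hN].
- (* - m + 2 (|N| + m) = m + 2 |N| is at least N *)
  have := hN (- m%:Z + (`|N|%N + m).*2%:Z).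
  by rewrite subr_gt0 alt odd_double => h; have := h ltac:(lia).
- have := hN (- m%:Z + (`|N|%N + m).*2.+1%:Z).
  rewrite subr_lt0 => h; have /ltW := h ltac:(lia).
  by rewrite leNgt alt /= odd_double.
Qed.
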